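(* Let $n$ be a positive integer, let $w_1,w_2,\dots,w_n$ be positive integers and let $x\in\mathbb{Z}_p$. For a permutation $\sigma$ in the symmetric group $S_n$ of degree $n$, put $W_\sigma=w_{\sigma(1)}w_{\sigma(2)}\cdots w_{\sigma(n-1)}$. Then the expression $$\frac{1}{[W_\sigma]_q}\sum_{k_1=0}^{w_{\sigma(1)}-1}\cdots\sum_{k_{n-1}=0}^{w_{\sigma(n-1)}-1} q^{\,w_{\sigma(n)}\sum_{j=1}^{n-1}\left(\prod_{1\le i\le n-1,\, i\ne j}w_{\sigma(i)}\right)k_j}\int_{\mathbb{Z}_p}(1+\lambda t)^{\frac1\lambda\left[W_\sigma y+\left(\prod_{j=1}^{n}w_j\right)x+w_{\sigma(n)}\sum_{j=1}^{n-1}\left(\prod_{1\le i\le n-1,\, i\neq j}w_{\sigma(i)}\right)k_j\right]_q}\,d\mu_{q^{W_\sigma}}(y)$$ takes the same value for every permutation $\sigma\in S_n$.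
   Context: Let $p$ be a fixed odd prime, $\mathbb{Z}_p$ the ring of $p$-adic integers, and $\mathbb{C}_p$ the completion of the algebraic closure of $\mathbb{Q}_p$, with norm normalized by $|p|_p=1/p$. Let $q\in\mathbb{C}_p$, $q\neq 1$, with $|1-q|_p<p^{-1/(p-1)}$. Write $q^a=\exp(a\log q)$ for $a\in\mathbb{Z}_p$, and $[a]_q=\frac{1-q^a}{1-q}$. Let $\lambda,t\in\mathbb{C}_p$ with $\lambda\ne 0$, $|\lambda|_p\le 1$ and $|t|_p<p^{-1/(p-1)}$. The power is defined by the binomial series $(1+\lambda t)^{z/\lambda}=\sum_{m\ge 0}\binom{z/\lambda}{m}\lambda^m t^m$. For $Q\in\mathbb{C}_p$, $Q\ne1$, with $|1-Q|_p<p^{-1/(p-1)}$ and $f:\mathbb{Z}_p\to\mathbb{C}_p$ uniformly differentiable, the $p$-adic $q$-integral with parameter $Q$ is $$\int_{\mathbb{Z}_p}f(y)\,d\mu_Q(y)=\lim_{N\to\infty}\frac{1}{[p^N]_Q}\sum_{y=0}^{p^N-1}f(y)Q^y .$$ Empty products equal $1$, empty sums in exponents equal $0$, and for $n=1$ the iterated sum over the $k_j$ has a single term. *)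

(* Defs.v *)
From mathcomp Require Import all_boot all_order all_algebra all_fingroup.
From mathcomp Require Import all_classical all_reals all_analysis.
Import numFieldNormedType.Exports.

Set Implicit Arguments.
Unset Strict Implicit.
Unset Printing Implicit Defensive.

Import Order.TTheory GRing.Theory Num.Theory.
Local Open Scope classical_set_scope.
Local Open Scope ring_scope.

(* The absolute value is a bare function v : K -> R: MathComp's normedZmodType
   requires `|x *+ n| = `|x| *+ n, which no non-archimedean norm satisfies. *)
Section ValuedField.
Variables (R : realType) (K : fieldType) (v : K -> R).

Definition vcvg (u : nat -> K) (l : K) : Prop :=
  (fun m => v (u m - l)) @ \oo --> (0 : R).

(* Total operator: 0 when there is no limit. *)
Definition vlim (u : nat -> K) : K := xget 0 [set l | vcvg u l].

Definition vsum (a : nat -> K) : K := vlim (fun N => \sum_(0 <= m < N) a m).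

Definition vcauchy (u : nat -> K) : Prop :=
  forall e : R, 0 < e -> exists N : nat, forall m m' : nat,
    (N <= m)%N -> (N <= m')%N -> v (u m - u m') < e.

(* When K is complete and v restricts to the p-adic absolute value on the
   rationals, the closure of the rationals in K is the field of p-adic
   numbers. *)
Definition in_Qp (x : K) : Prop := exists u : nat -> rat, vcvg (ratr \o u) x.

Definition in_Zp (x : K) : Prop := in_Qp x /\ v x <= 1.

Definition in_Qpbar (x : K) : Prop :=
  exists P : {poly K}, [/\ P != 0, (forall i : nat, in_Qp P`_i) & root P x].

(* K is the completion of an algebraic closure of Q_p; this determines (K, v)
   up to isometric isomorphism. The ultrametric inequality and v p = 1/p force
   characteristic 0 and the p-adic absolute value on the rationals. *)
Record is_Cp (p : nat) : Prop := IsCp {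
  v_ge0 : forall x : K, 0 <= v x;
  v_eq0 : forall x : K, v x = 0 <-> x = 0;
  v_mul : forall x y : K, v (x * y) = v x * v y;
  v_add : forall x y : K, v (x + y) <= Num.max (v x) (v y);
  v_p : v p%:R = p%:R^-1;
  v_complete : forall u : nat -> K, vcauchy u -> exists l : K, vcvg u l;
  Qpbar_closed : forall P : {poly K}, (1 < size P)%N ->
    (forall i : nat, in_Qpbar P`_i) -> exists2 x : K, in_Qpbar x & root P x;
  Qpbar_dense : forall (x : K) (e : R), 0 < e ->
    exists2 y : K, in_Qpbar y & v (x - y) < e
}.

Definition vexp (z : K) : K := vsum (fun m => z ^+ m / m`!%:R).

Definition vlog (u : K) : K :=
  vsum (fun m => (-1) ^+ m * (u - 1) ^+ m.+1 / m.+1%:R).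

Definition qpow (q a : K) : K := vexp (a * vlog q).

Definition qnum (q a : K) : K := (1 - qpow q a) / (1 - q).

Definition gbinom (a : K) (m : nat) : K := (\prod_(i < m) (a - i%:R)) / m`!%:R.

(* (1 + lam t)^(z / lam) *)
Definition dpow (lam t z : K) : K :=
  vsum (fun m => gbinom (z / lam) m * lam ^+ m * t ^+ m).

(* Only the values of f at natural numbers, a dense subset of Z_p, matter. *)
Definition qintegral (p : nat) (Q : K) (f : K -> K) : K :=
  vlim (fun N => (qnum Q (p ^ N)%:R)^-1 *
                 \sum_(0 <= y < p ^ N) f y%:R * qpow Q y%:R).

End ValuedField.

(* Weights are indexed by 'I_n.+1, so n is one less than the degree of the
   symmetric group: the last index is ord_max and the others are the
   init_ord i. *)
Definition init_ord (n : nat) (i : 'I_n) : 'I_n.+1 := widen_ord (leqnSn n) i.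

Section Expression.
Variables (n : nat) (w : 'I_n.+1 -> nat) (s : 'S_n.+1).

Definition Wprod : nat := (\prod_(i < n) w (s (init_ord i)))%N.

Definition multi_index : finType :=
  {dffun forall j : 'I_n, 'I_(w (s (init_ord j)))}.

Definition kshift (k : multi_index) : nat :=
  (w (s ord_max) *
   \sum_(j < n) (\prod_(i < n | i != j) w (s (init_ord i))) * k j)%N.

Definition sym_expr (R : realType) (K : fieldType) (v : K -> R) (p : nat)
    (q lam t x : K) : K :=
  (qnum v q Wprod%:R)^-1 *
  \sum_(k : multi_index)
    qpow v q (kshift k)%:R *
    qintegral v p (qpow v q Wprod%:R)
      (fun y => dpow v lam t
         (qnum v q (Wprod%:R * y + (\prod_(j < n.+1) w j)%N%:R * x
                    + (kshift k)%:R))).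

End Expression.

(* Main.v *)
(* Write <f>_M = [M]_Q^-1 * sum_(y < M) f(y) Q^y, with Q = q^W. The integral of f
   is the limit of <f>_(p^N), and it is also the limit of <f>_(w p^N) for every
   fixed w > 0: for f a power of Q^y the average is an explicit geometric sum,
   and if f satisfies |f(a+b) - f(a)| <= e |b| then
   |<f>_(wM) - <f>_M| <= e/|w|; the function to be integrated is a polynomial in
   Q^y up to an error of the second kind with e arbitrarily small.
   Taking w = w_(s n) turns the expression attached to s into the limit of
   averages over z < p^N of a function of P z + e, P the product of all weights,
   summed over all e = sum_j (P / w_j) k_j with k_j < w_j. The generating
   polynomial of these e is prod_j sum_(a < w_j) X^((P / w_j) a), where s no
   longer occurs. *)
Require Import Defs.
From mathcomp Require Import all_boot all_order all_algebra all_fingroup.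
From mathcomp Require Import all_classical all_reals all_analysis.
From mathcomp Require Import ring zify.

Set Implicit Arguments.
Unset Strict Implicit.
Unset Printing Implicit Defensive.

Import numFieldNormedType.Exports.
Import Order.TTheory GRing.Theory Num.Theory.
Local Open Scope ring_scope.

(** * Reindexing of finite sums *)

Lemma sum_nat_mul (V : nmodType) (F : nat -> V) (m n : nat) :
  \sum_(0 <= y < m * n) F y =
  \sum_(0 <= i < m) \sum_(0 <= y < n) F (y + i * n)%N.
Proof.
elim: m => [|m IH]; first by rewrite mul0n !big_geq.
rewrite big_nat_recr //= -IH mulSnr (@big_cat_nat _ _ _ (m * n)) ?leq_addr //=.
by congr (_ + _); rewrite -{1}[(m * n)%N]add0n big_addn addKn.
Qed.

(** Distributivity with ranges that depend on the index: [big_fprod] passes to functions into the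
    tagged union, where [bigA_distr_big_dep] applies, and [big_tag] returns to the individual
    ranges. *)
Lemma sum_dffun_prod (S : pzSemiRingType) (I : finType) (m : I -> nat)
    (F : forall i : I, 'I_(m i) -> S) :
  \sum_(k : {dffun forall i : I, 'I_(m i)}) \prod_(i : I) F i (k i) =
  \prod_(i : I) \sum_(a < m i) F i a.
Proof.
rewrite (reindex (@dffun_of_fprod _ _)) /=; last first.
  exact/onW_bij/dffun_of_fprod_bij.
transitivity (\sum_(t : fprod (fun i => 'I_(m i))) \prod_(i in I) finfun (F i) (t i)).
  by apply: eq_bigr => t _; apply: eq_bigr => i _; rewrite !ffunE.
rewrite big_fprod -(bigA_distr_big_dep _ (fun i j => untag 0 (finfun (F i)) j)).
apply: eq_bigr => i _.
apply: etrans (esym (big_tag (fun i a => finfun (F i) a) i)) _.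
by apply: eq_bigr => a _; rewrite ffunE.
Qed.

Section SymmetricSum.
Variable K : fieldType.

(** The coefficient of X^m in the generating polynomial counts how often the value m is taken, and
    these multiplicities determine the sum of [H] over all values. *)
Lemma eq_sum_of_eq_sum_Xn (I J : finType) (e : I -> nat) (e' : J -> nat)
    (H : nat -> K) :
  \sum_i 'X^(e i) = \sum_j 'X^(e' j) :> {poly K} ->
  \sum_i H (e i) = \sum_j H (e' j).
Proof.
move=> E; pose N := (\max_i e i + \max_j e' j).+1.
have expand (T : finType) (g : T -> nat) : (forall i, g i < N)%N ->
    \sum_i H (g i) = \sum_(m < N) (\sum_i 'X^(g i) : {poly K})`_m * H m.
  move=> gN; under [RHS]eq_bigr do rewrite coef_sum mulr_suml.
  rewrite exchange_big; apply: eq_bigr => i _ /=.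
  rewrite (bigD1 (Ordinal (gN i))) //= coefXn eqxx mul1r big1 ?addr0 // => m ne.
  by rewrite coefXn -val_eqE /= in ne *; rewrite (negbTE ne) mul0r.
rewrite !expand ?E // => i; rewrite ltnS.
  by apply: leq_trans (leq_addl _ _); apply: leq_bigmax.
by apply: leq_trans (leq_addr _ _); apply: leq_bigmax.
Qed.

Variables (n : nat) (w : 'I_n.+1 -> nat).

Lemma prod_others (s : 'S_n.+1) (m : 'I_n.+1) :
  (\prod_(i | i != s m) w i = \prod_(i | i != m) w (s i))%N.
Proof.
rewrite (reindex_inj (@perm_inj _ s)) /=; apply: eq_bigl => i.
by rewrite (inj_eq perm_inj).
Qed.

Lemma prod_others_last (s : 'S_n.+1) :
  (\prod_(i | i != s ord_max) w i = Wprod w s)%N.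
Proof.
rewrite prod_others big_mkcond big_ord_recr /= eqxx muln1.
apply: eq_bigr => i _; rewrite ifT //.
by rewrite -val_eqE /= neq_ltn ltn_ord.
Qed.

Lemma prod_others_init (s : 'S_n.+1) (j : 'I_n) :
  (\prod_(i | i != s (init_ord j)) w i =
   w (s ord_max) * \prod_(i < n | i != j) w (s (init_ord i)))%N.
Proof.
rewrite prod_others big_mkcond big_ord_recr /= mulnC; congr (_ * _)%N.
  by rewrite ifT // -val_eqE /= neq_ltn ltn_ord orbT.
by rewrite [RHS]big_mkcond.
Qed.

Lemma Wprod_last (s : 'S_n.+1) : (Wprod w s * w (s ord_max) = \prod_i w i)%N.
Proof. by rewrite (reindex_inj (@perm_inj _ s)) big_ord_recr. Qed.

(** With P the product of all weights, each exponent is a sum over j of (P / w_j) times a digit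
    below w_j: [u.1] supplies the first n digits, and [u.2] the last one, whose coefficient is
    [Wprod w s]. The digits vary independently, so the sum factors. *)
Lemma sum_Xn_shift (s : 'S_n.+1) :
  \sum_(u : multi_index w s * 'I_(w (s ord_max)))
     'X^(Wprod w s * u.2 + kshift u.1) =
  \prod_(j < n.+1) \sum_(a < w j) 'X^((\prod_(i | i != j) w i) * a) :> {poly K}.
Proof.
rewrite [RHS](reindex_inj (@perm_inj _ s)) big_ord_recr /= prod_others_last.
rewrite -(pair_big xpredT xpredT
  (fun (k : multi_index w s) (i : 'I_(w (s ord_max))) =>
     'X^(Wprod w s * i + kshift k) : {poly K})) /=.
under [X in _ = X * _]eq_bigr => j _ do
  rewrite -[widen_ord _ j]/(init_ord j) prod_others_init.
rewrite -(sum_dffun_prod (fun j a => 'X^(w (s ord_max) *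
  \prod_(i < n | i != j) w (s (init_ord i)) * a))).
rewrite mulr_suml; apply: eq_bigr => k _; rewrite mulr_sumr; apply: eq_bigr => i _.
rewrite exprD mulrC; congr (_ * _); rewrite /kshift big_distrr /=.
rewrite (big_morph (fun e => 'X^e : {poly K}) (exprD 'X) (expr0 'X)).
by apply: eq_bigr => j _; rewrite mulnA.
Qed.

Lemma sum_shift_perm (s s' : 'S_n.+1) (H : nat -> K) :
  \sum_(u : multi_index w s * 'I_(w (s ord_max)))
     H (Wprod w s * u.2 + kshift u.1)%N =
  \sum_(u : multi_index w s' * 'I_(w (s' ord_max)))
     H (Wprod w s' * u.2 + kshift u.1)%N.
Proof.
pose e (s0 : 'S_n.+1) (u : multi_index w s0 * 'I_(w (s0 ord_max))) : nat :=
  (Wprod w s0 * u.2 + kshift u.1)%N.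
apply: (@eq_sum_of_eq_sum_Xn _ _ (e s) (e s')).
exact: etrans (sum_Xn_shift s) (esym (sum_Xn_shift s')).
Qed.

End SymmetricSum.

(** Legendre's formula gives the valuation as the sum of the quotients of m + 1 by powers of p.
    Times p - 1, this sum is strictly below m + 1, and the strictness yields the bound m. *)
Lemma logn_fact_leq (p m : nat) : prime p ->
  (p.-1 * logn p (m.+1)`! <= m)%N.
Proof.
move=> p_prime; rewrite -ltnS logn_fact //.
suff H j : (p.-1 * (\sum_(1 <= k < j.+1) m.+1 %/ p ^ k) < m.+1)%N by apply: H.
elim: j => [|j IH]; first by rewrite big_geq // muln0.
(* The last quotient is a reserve that pays for the next term, since p times the quotient by p^(i+1)
   is at most the quotient by p^i. *)
have inv i : (p.-1 * (\sum_(1 <= k < i.+1) m.+1 %/ p ^ k) + m.+1 %/ p ^ i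
              <= m.+1)%N.
  elim: i => [|i IHi]; first by rewrite big_geq // muln0 expn0 divn1.
  rewrite big_nat_recr //= mulnDr -addnA -mulSnr (ltn_predK (prime_gt1 p_prime)).
  apply: leq_trans IHi; rewrite leq_add2l expnSr divnMA.
  by rewrite mulnC leq_divM.
(* A zero quotient adds nothing to the sum; a positive one is a reserve that makes the inequality
   strict. *)
have [z|nz] := posnP (m.+1 %/ p ^ j.+1).
  by rewrite big_nat_recr //= z addn0.
by apply: leq_trans (inv j.+1); rewrite -addn1 leq_add2l.
Qed.

(** * The absolute value of C_p and limits *)

Section CpTheory.
Variables (R : realType) (p : nat) (K : fieldType) (v : K -> R).
Hypotheses (p_prime : prime p) (CpK : is_Cp v p).

Let vM := v_mul CpK.
Let vge0 := v_ge0 CpK.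

Lemma v0 : v 0 = 0. Proof. exact/(v_eq0 CpK). Qed.

Lemma v_neq0 (x : K) : (v x != 0) = (x != 0).
Proof. by congr negb; apply/eqP/eqP => /(v_eq0 CpK). Qed.

Lemma v_gt0 (x : K) : (0 < v x) = (x != 0).
Proof. by rewrite lt_def vge0 andbT v_neq0. Qed.

Lemma v1 : v 1 = 1.
Proof.
have n0 : v 1 != 0 by rewrite v_neq0 oner_neq0.
by apply: (mulfI n0); rewrite -vM !mulr1.
Qed.

Lemma vN (x : K) : v (- x) = v x.
Proof.
suff h : v (-1) = 1 by rewrite -mulN1r vM h mul1r.
apply/eqP; rewrite -(eqrXn2 (n:=2)) // expr1n expr2 -vM mulrNN mulr1 v1 //.
Qed.

Lemma v_distC (x y : K) : v (x - y) = v (y - x).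
Proof. by rewrite -vN opprB. Qed.

Lemma vD_le (x y : K) (c : R) : v x <= c -> v y <= c -> v (x + y) <= c.
Proof. by move=> xc yc; apply: le_trans (v_add CpK x y) _; rewrite ge_max xc. Qed.

Lemma vB_le (x y : K) (c : R) : v x <= c -> v y <= c -> v (x - y) <= c.
Proof. by move=> xc yc; apply: vD_le; rewrite ?vN. Qed.

Lemma vD_lt (x y : K) (c : R) : v x < c -> v y < c -> v (x + y) < c.
Proof.
by move=> xc yc; apply: le_lt_trans (v_add CpK x y) _; rewrite gt_max xc.
Qed.

Lemma v_dominant (x y : K) : v y < v x -> v (x + y) = v x.
Proof.
move=> yx; apply/eqP; rewrite eq_le vD_le ?lexx ?(ltW yx) //= leNgt; apply/negP => h.
by have := @vD_lt (x + y) (- y) (v x) h; rewrite vN addrK ltxx => /(_ yx).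
Qed.

Lemma vX (x : K) (m : nat) : v (x ^+ m) = v x ^+ m.
Proof. by elim: m => [|m IH]; rewrite ?v1 // !exprS vM IH. Qed.

Lemma vV (x : K) : v x^-1 = (v x)^-1.
Proof.
have [->|x0] := eqVneq x 0; first by rewrite invr0 v0 invr0.
have n0 : v x != 0 by rewrite v_neq0.
by apply: (mulfI n0); rewrite -vM !mulfV // v1.
Qed.

Lemma v_sum_le (I : Type) (s : seq I) (P : pred I) (F : I -> K) (c : R) :
  0 <= c -> (forall i, P i -> v (F i) <= c) -> v (\sum_(i <- s | P i) F i) <= c.
Proof.
move=> c0 h; elim/big_ind: _ => //; first by rewrite v0.
by move=> x y; apply: vD_le.
Qed.

Lemma v_prod_le1 (I : Type) (s : seq I) (P : pred I) (F : I -> K) :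
  (forall i, P i -> v (F i) <= 1) -> v (\prod_(i <- s | P i) F i) <= 1.
Proof.
move=> h; elim/big_ind: _ => //; first by rewrite v1.
by move=> x y hx hy; rewrite vM mulr_ile1.
Qed.

Lemma v_nat_le1 (n : nat) : v n%:R <= 1.
Proof.
elim: n => [|n IH]; first by rewrite v0.
by rewrite -addn1 natrD vD_le // v1.
Qed.

Let p_gt0 : (0 : R) < p%:R. Proof. by rewrite ltr0n prime_gt0. Qed.

Lemma v_p_lt1 : v p%:R < 1.
Proof. by rewrite (v_p CpK) invf_lt1 // ltr1n prime_gt1. Qed.

(** By Bezout some multiple b n is 1 plus a multiple of p, hence has absolute value 1; as |b| and
    |n| are at most 1, both equal 1. *)
Lemma v_nat_coprime (n : nat) : coprime p n -> v n%:R = 1.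
Proof.
move=> co.
have n0 : (0 < n)%N.
  by case: n co => //; rewrite /coprime gcdn0 => /eqP p1; move: p_prime; rewrite p1.
have [a _ /dvdnP[b /esym E]] := Bezoutl p n0.
move: E; rewrite gcdnC (eqP co) => E.
have : v (b%:R * n%:R) = 1.
  by rewrite -natrM E natrD v_dominant ?v1 // natrM vM
     (le_lt_trans (ler_piMl (vge0 _) (v_nat_le1 _))) // v_p_lt1.
rewrite vM => h; apply/eqP; rewrite eq_le v_nat_le1 /= -h.
by rewrite ler_piMl // v_nat_le1.
Qed.

Lemma v_nat (n : nat) : (0 < n)%N -> v n%:R = (p%:R ^- logn p n : R).
Proof.
move=> n0; have [m co E] := pfactor_coprime p_prime n0.
have m0 : (0 < m)%N by move: n0; rewrite {1}E muln_gt0 => /andP[].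
by rewrite [in LHS]E natrM natrX vM vX (v_nat_coprime co) (v_p CpK) mul1r exprVn.
Qed.

Lemma v_nat_gt0 (n : nat) : (0 < n)%N -> 0 < v n%:R.
Proof. by move=> n0; rewrite v_nat // invr_gt0 exprn_gt0. Qed.

Lemma natr_neq0 (n : nat) : (0 < n)%N -> n%:R != 0 :> K.
Proof. by move=> n0; rewrite -v_neq0 gt_eqF // v_nat_gt0. Qed.

(* r = p^(-1/(p-1)), the radius of convergence of the exponential. *)
Variable (r : R).
Hypotheses (r_gt0 : 0 < r) (r_pow : r ^+ p.-1 = p%:R^-1).

Lemma r_le1 : r <= 1.
Proof.
rewrite leNgt; apply/negP => h.
have : 1 <= r ^+ p.-1 by apply: exprn_ege1; apply: ltW.
by rewrite r_pow leNgt invf_lt1 // ltr1n prime_gt1.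
Qed.

(** This is [logn_fact_leq] rewritten with 1/p = r^(p-1). Having exponent m instead of m + 1 keeps a
    full factor |h| in front of the bound of [v_div_fact]. *)
Lemma v_fact_ge (m : nat) : r ^+ m <= v (m.+1)`!%:R.
Proof.
rewrite v_nat ?fact_gt0 // -exprVn -r_pow -exprM.
by apply: ler_wiXn2l; rewrite ?r_le1 ?logn_fact_leq // ltW.
Qed.

Lemma v_div_fact (h : K) (m : nat) :
  v (h ^+ m.+1 / (m.+1)`!%:R) <= v h * (v h / r) ^+ m.
Proof.
rewrite vM vV vX exprS -mulrA ler_wpM2l // expr_div_n ler_wpM2l ?exprn_ge0 //.
by rewrite lef_pV2 ?posrE ?exprn_gt0 ?v_nat_gt0 ?fact_gt0 // v_fact_ge.
Qed.

Lemma v_div_fact_geo (h : K) (m : nat) : v h < r ->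
  v (h ^+ m / m`!%:R) <= (v h / r) ^+ m.
Proof.
case: m => [|m] hr; first by rewrite fact0 invr1 mulr1 v1.
apply: le_trans (v_div_fact _ _) _; rewrite exprS ler_wpM2r //.
  by rewrite exprn_ge0 // divr_ge0 // ltW.
by rewrite ler_pdivlMr // ler_piMr // r_le1.
Qed.

Lemma vcvgP (u : nat -> K) (l : K) :
  vcvg v u l <-> forall e, 0 < e ->
    exists N : nat, forall m, (N <= m)%N -> v (u m - l) < e.
Proof.
split=> [/cvgr0Pnorm_lt h e e0|h].
  have [N _ hN] := h e e0; exists N => m Nm.
  by have := hN m Nm; rewrite /= ger0_norm.
apply/cvgr0Pnorm_lt => e e0; have [N hN] := h e e0.
by exists N => // m /= Nm; rewrite ger0_norm // hN.
Qed.

Lemma vcvg_unique (u : nat -> K) (l l' : K) :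
  vcvg v u l -> vcvg v u l' -> l = l'.
Proof.
move=> /vcvgP h /vcvgP h'; apply/eqP; rewrite -subr_eq0 -[_ == _]negbK.
rewrite -v_gt0; apply/negP => e0.
have [N hN] := h _ e0; have [N' hN'] := h' _ e0.
have := @vD_lt (l - u (maxn N N')) (u (maxn N N') - l') (v (l - l')).
rewrite [v (l - u _)]v_distC hN ?leq_maxl // hN' ?leq_maxr // addrA subrK ltxx.
by move=> /(_ isT isT).
Qed.

Lemma vlimE (u : nat -> K) (l : K) : vcvg v u l -> vlim v u = l.
Proof.
move=> ul; apply: (@vcvg_unique u) => //.
by rewrite /vlim; apply: (@xgetPex _ 0 [set l | vcvg v u l]%classic); exists l.
Qed.

Lemma vcvg_cst (c : K) : vcvg v (fun=> c) c.
Proof. by apply/vcvgP => e e0; exists 0%N => m _; rewrite subrr v0. Qed.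

Lemma vcvg_close (u u' : nat -> K) (l l' : K) :
  vcvg v u l -> vcvg v (fun m => u' m - u m) l' -> vcvg v u' (l + l').
Proof.
move=> /vcvgP h /vcvgP h'; apply/vcvgP => e e0.
have [N hN] := h e e0; have [N' hN'] := h' e e0.
exists (maxn N N') => m; rewrite geq_max => /andP[Nm N'm].
rewrite (_ : _ - _ = (u' m - u m - l') + (u m - l)); last by ring.
by apply: vD_lt; [apply: hN' | apply: hN].
Qed.

Lemma vcvgD (u u' : nat -> K) (l l' : K) :
  vcvg v u l -> vcvg v u' l' -> vcvg v (fun m => u m + u' m) (l + l').
Proof.
move=> h h'; apply: (vcvg_close h).
by under [X in vcvg v X]eq_fun do rewrite addrC addKr.
Qed.

Lemma vcvg_ext (u u' : nat -> K) (l : K) :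
  vcvg v u l -> (forall m, u m = u' m) -> vcvg v u' l.
Proof. by move=> h /funext <-. Qed.

Lemma vcvgMl (c : K) (u : nat -> K) (l : K) :
  vcvg v u l -> vcvg v (fun m => c * u m) (c * l).
Proof.
move=> /vcvgP h; apply/vcvgP => e e0.
have [->|c0] := eqVneq c 0.
  by exists 0%N => m _; rewrite !mul0r subrr v0.
have [N hN] := h (e / v c) (divr_gt0 e0 (etrans (v_gt0 c) c0)).
exists N => m Nm; rewrite -mulrBr vM mulrC -ltr_pdivlMr ?v_gt0 //.
exact: hN.
Qed.

Lemma vcvg_sum (I : Type) (s : seq I) (u : I -> nat -> K) (l : I -> K) :
  (forall i, vcvg v (u i) (l i)) ->
  vcvg v (fun m => \sum_(i <- s) u i m) (\sum_(i <- s) l i).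
Proof.
move=> h; elim: s => [|i s IH].
  by rewrite big_nil; apply: vcvg_ext (vcvg_cst 0) _ => m; rewrite big_nil.
rewrite big_cons; apply: vcvg_ext (vcvgD (h i) IH) _ => m.
by rewrite big_cons.
Qed.

Lemma vcvg_bound (u : nat -> K) (l c : K) (b : R) (N : nat) :
  vcvg v u l -> (forall m, (N <= m)%N -> v (u m - c) <= b) -> v (l - c) <= b.
Proof.
move=> /vcvgP h ub; rewrite leNgt; apply/negP => bl.
have e0 : 0 < v (l - c).
  by apply: le_lt_trans bl; apply: le_trans (ub N _).
have [N' hN] := h _ e0.
have := hN (maxn N N') (leq_maxr _ _); rewrite v_distC => lt1.
have := @vD_lt (l - u (maxn N N')) (u (maxn N N') - c) _ lt1.
rewrite addrA subrK ltxx => H; apply/notF/H.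
by apply: le_lt_trans bl; apply: ub; rewrite leq_maxl.
Qed.

(** By the ultrametric inequality a difference of two terms is at most the largest increment between
    them, so small increments already make the sequence Cauchy. *)
Lemma vcvg_increments (u : nat -> K) :
  vcvg v (fun m => u m.+1 - u m) 0 -> exists l, vcvg v u l.
Proof.
move=> /vcvgP h; apply: (v_complete CpK) => e e0; have [N hN] := h e e0.
exists N.
have H k : v (u (N + k)%N - u N) < e.
  elim: k => [|k IH]; first by rewrite addn0 subrr v0.
  rewrite (_ : _ - _ = (u (N + k).+1 - u (N + k)%N - 0) + (u (N + k)%N - u N));
    last by rewrite addnS; ring.
  by apply: vD_lt => //; apply: hN; rewrite leq_addr.
move=> m m' /subnKC <- /subnKC <-.
rewrite (_ : _ - _ = (u (N + (m - N))%N - u N) + (u N - u (N + (m' - N))%N));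
  last by ring.
by apply: vD_lt => //; rewrite v_distC.
Qed.

Lemma expr_cvg0 (a e : R) : 0 <= a -> a < 1 -> 0 < e ->
  exists N : nat, forall m, (N <= m)%N -> a ^+ m < e.
Proof.
move=> a0 a1 e0.
have /cvgr0Pnorm_lt/(_ e e0)[N _ hN] : (GRing.exp a @ \oo --> (0 : R))%classic.
  by apply: cvg_expr; rewrite ger0_norm.
by exists N => m Nm; have := hN m Nm; rewrite /= ger0_norm // exprn_ge0.
Qed.

Lemma vsum_cvg (a : nat -> K) (theta : R) :
  0 <= theta -> theta < 1 -> (forall m, v (a m) <= theta ^+ m) ->
  vcvg v (fun N => \sum_(0 <= m < N) a m) (vsum v a).
Proof.
move=> t0 t1 h.
suff [l hl] : exists l, vcvg v (fun N => \sum_(0 <= m < N) a m) l.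
  by rewrite /vsum (vlimE hl).
apply: vcvg_increments; apply/vcvgP => e e0.
have [N hN] := expr_cvg0 t0 t1 e0; exists N => m Nm.
rewrite subr0 big_nat_recr //= addrAC subrr add0r.
by apply: le_lt_trans (hN m Nm).
Qed.

Lemma vcvg_tail (a : nat -> K) (l : K) (c : R) (N : nat) :
  vcvg v (fun N => \sum_(0 <= m < N) a m) l ->
  (forall m, (N <= m)%N -> v (a m) <= c) ->
  v (l - \sum_(0 <= m < N) a m) <= c.
Proof.
move=> h ac; apply: (vcvg_bound (N := N) h) => m Nm.
rewrite (@big_cat_nat _ _ _ N 0 m) //= addrAC subrr add0r.
rewrite big_nat; apply: v_sum_le => [|i /andP[Ni _]]; last exact: ac.
exact: le_trans (vge0 _) (ac N _).
Qed.

Lemma v_pX (m : nat) : v (p ^ m)%:R = p%:R^-1 ^+ m.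
Proof. by rewrite natrX vX (v_p CpK). Qed.

Lemma v_pX_cvg (e : R) : 0 < e ->
  exists N : nat, forall m, (N <= m)%N -> v (p ^ m)%:R < e.
Proof.
move=> e0; have [||N hN] := @expr_cvg0 p%:R^-1 e _ _ e0.
- by rewrite invr_ge0 ltW.
- by rewrite invf_lt1 // ltr1n prime_gt1.
by exists N => m Nm; rewrite v_pX hN.
Qed.

(** * Exponential and logarithm *)

Let ratio_ge0 (h : K) : 0 <= v h / r. Proof. by rewrite divr_ge0 // ltW. Qed.

Let ratio_lt1 (h : K) : v h < r -> v h / r < 1.
Proof. by move=> hr; rewrite ltr_pdivrMr // mul1r. Qed.

Lemma vexp_cvg (z : K) : v z < r ->
  vcvg v (fun N => \sum_(0 <= m < N) z ^+ m / m`!%:R) (vexp v z).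
Proof.
move=> zr; apply: (@vsum_cvg _ (v z / r)) => // [|m]; first exact: ratio_lt1.
exact: v_div_fact_geo.
Qed.

Lemma vexp_sub1_le (z : K) : v z < r -> v (vexp v z - 1) <= v z.
Proof.
move=> zr; have := @vcvg_tail _ _ (v z) 1 (vexp_cvg zr).
rewrite big_nat1 fact0 invr1 mulr1; apply=> -[//|m] _.
apply: le_trans (v_div_fact _ _) _; rewrite ler_piMr //.
by rewrite exprn_ile1 // ltW // ratio_lt1.
Qed.

(** The error is quadratic in z; applied to M z it is o(M) as M tends to 0 p-adically, as
    [vexp_vlog] requires. *)
Lemma vexp_sub_linear_le (z : K) : v z < r ->
  v (vexp v z - 1 - z) <= v z * (v z / r).
Proof.
move=> zr; have := @vcvg_tail _ _ (v z * (v z / r)) 2 (vexp_cvg zr).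
rewrite 2?big_nat_recl // big_geq // !fact0 !invr1 !mulr1 addr0 opprD addrA.
apply=> -[|[|m]] // _.
apply: le_trans (v_div_fact _ _) _; rewrite ler_wpM2l // exprS ler_piMr //.
by rewrite exprn_ile1 // ltW // ratio_lt1.
Qed.

Lemma vexp0 : vexp v 0 = 1.
Proof.
have := @vexp_sub1_le 0; rewrite v0 => /(_ r_gt0) h.
apply/eqP; rewrite -subr_eq0 -[_ == 0]negbK -v_neq0 negbK.
by rewrite eq_le h vge0.
Qed.

Lemma v_vexp (z : K) : v z < r -> v (vexp v z) = 1.
Proof.
move=> zr; rewrite -(subrKC 1 (vexp v z)) v_dominant v1 //.
apply: le_lt_trans (vexp_sub1_le zr) (lt_le_trans zr r_le1).
Qed.

(** The product of the partial sums runs over the square i, j < N, and the partial sum for a + b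
    over the triangle i + j < N. Each remaining term has i + j >= N and is bounded by the N-th power
    of the ratio. *)
Lemma exp_partial_mul (a b : K) (N : nat) :
  v a < r -> v b < r ->
  v ((\sum_(0 <= m < N) a ^+ m / m`!%:R) * (\sum_(0 <= m < N) b ^+ m / m`!%:R)
     - \sum_(0 <= m < N) (a + b) ^+ m / m`!%:R)
  <= (Num.max (v a) (v b) / r) ^+ N.
Proof.
move=> ar br; set th := Num.max _ _ / r.
have th0 : 0 <= th by rewrite divr_ge0 ?(ltW r_gt0) // le_max vge0.
have th1 : th <= 1 by rewrite ler_pdivrMr // mul1r ge_max !ltW.
have bnd c m : v c < r -> v c / r <= th -> v (c ^+ m / m`!%:R) <= th ^+ m.
  move=> cr cth; apply: le_trans (v_div_fact_geo _ cr) _.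
  by apply: lerXn2r; rewrite ?nnegrE.
pose F i j := (a ^+ i / i`!%:R) * (b ^+ j / j`!%:R).
(* Binomial theorem, then summation over i and j = m - i in place of m. *)
have -> : \sum_(0 <= m < N) (a + b) ^+ m / m`!%:R =
          \sum_(0 <= i < N) \sum_(0 <= j < N | (i + j < N)%N) F i j.
  transitivity (\sum_(0 <= m < N) \sum_(0 <= i < N | (i <= m)%N) F i (m - i)%N).
    apply: eq_big_nat => m /andP[_ mN]; rewrite addrC exprDn mulr_suml.
    rewrite -(big_mkord xpredT (fun i => b ^+ (m - i) * a ^+ i *+ 'C(m, i) / m`!%:R)).
    rewrite (big_nat_widen _ _ N) //; apply: eq_big => // i /andP[_ im].
    have hb := @bin_fact m i im; rewrite -hb !natrM /F -mulr_natl.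
    field; rewrite !natr_neq0 ?fact_gt0 ?bin_gt0 //.
  rewrite (exchange_big_dep_nat xpredT) //=.
  apply: eq_big_nat => i /andP[_ iN].
  transitivity (\sum_(i <= j < N) F i (j - i)%N).
    by rewrite (big_nat_widenl i 0).
  rewrite -{1}(add0n i) big_addn (big_nat_widen _ _ N) ?leq_subr //.
  by apply: eq_big => j; rewrite ?addnK // ltn_subRL.
rewrite mulr_suml -sumrB big_nat; apply: v_sum_le => [|i _]; first exact: exprn_ge0.
rewrite mulr_sumr (bigID (fun j => (i + j < N)%N)) /= addrAC subrr add0r.
apply: v_sum_le => [|j]; first exact: exprn_ge0.
rewrite -leqNgt vM => Nij; apply: le_trans (ler_wiXn2l th0 th1 Nij).
by rewrite exprD ler_pM // bnd // ler_wpM2r ?invr_ge0 ?(ltW r_gt0) // le_max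
   lexx ?orbT.
Qed.

Lemma vexpD (a b : K) : v a < r -> v b < r ->
  vexp v (a + b) = vexp v a * vexp v b.
Proof.
move=> ar br; have abr := vD_lt ar br.
set th := Num.max (v a) (v b) / r.
have th0 : 0 <= th by rewrite divr_ge0 ?(ltW r_gt0) // le_max vge0.
have th1 : th < 1 by rewrite ltr_pdivrMr // mul1r gt_max ar.
have ca := vexp_cvg ar; have cb := vexp_cvg br; have cab := vexp_cvg abr.
set A := (fun N => _) in ca; set B := (fun N => _) in cb.
have vB N : v (B N) <= 1.
  apply: v_sum_le => // m _; apply: le_trans (v_div_fact_geo _ br) _.
  by rewrite exprn_ile1 // ltW // ratio_lt1.
have cAB : vcvg v (fun N => A N * B N) (vexp v a * vexp v b).
  apply/vcvgP => e e0.
  have [N1 h1] := (vcvgP _ _).1 ca e e0.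
  have [N2 h2] := (vcvgP _ _).1 cb e e0.
  exists (maxn N1 N2) => N; rewrite geq_max => /andP[/h1 hA /h2 hB].
  rewrite (_ : _ - _ = (A N - vexp v a) * B N + vexp v a * (B N - vexp v b));
    last by ring.
  apply: vD_lt; rewrite vM; last by rewrite v_vexp // mul1r.
  by apply: le_lt_trans hA; rewrite ler_piMr.
apply: (vcvg_unique _ cAB); rewrite -[vexp v (a + b)]addr0.
apply: (vcvg_close cab); apply/vcvgP => e e0.
have [N hN] := expr_cvg0 th0 th1 e0; exists N => m Nm; rewrite subr0.
exact: le_lt_trans (exp_partial_mul _ ar br) (hN m Nm).
Qed.

Lemma v_natM_le (n : nat) (z : K) : v (n%:R * z) <= v z.
Proof. by rewrite vM ler_piMl // v_nat_le1. Qed.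

Lemma vexp_natM (n : nat) (z : K) : v z < r ->
  vexp v (n%:R * z) = vexp v z ^+ n.
Proof.
move=> zr; elim: n => [|n IH]; first by rewrite mul0r vexp0.
rewrite mulrS mulrDl mul1r vexpD ?IH -?exprS //.
exact: le_lt_trans (v_natM_le _ _) zr.
Qed.

Lemma v_div_succ (h : K) (m : nat) :
  v (h ^+ m.+1 / m.+1%:R) <= v h * (v h / r) ^+ m.
Proof.
apply: le_trans (v_div_fact h m); rewrite !vM !vV ler_wpM2l //.
rewrite lef_pV2 ?posrE ?v_nat_gt0 ?fact_gt0 //.
by rewrite factS natrM vM ler_piMr // v_nat_le1.
Qed.

Lemma v_div_succ_le (h : K) (m : nat) : v h < r ->
  v (h ^+ m.+1 / m.+1%:R) <= v h.
Proof.
move=> hr; apply: le_trans (v_div_succ _ _) _.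
by rewrite ler_piMr // exprn_ile1 // ltW // ratio_lt1.
Qed.

Lemma v_signM (m : nat) (z : K) : v ((-1) ^+ m * z) = v z.
Proof. by rewrite vM vX vN v1 expr1n mul1r. Qed.

Lemma vlog_cvg (u : K) : v (u - 1) < r ->
  vcvg v (fun N => \sum_(0 <= m < N) (-1) ^+ m * (u - 1) ^+ m.+1 / m.+1%:R)
    (vlog v u).
Proof.
move=> ur; apply: (@vsum_cvg _ (v (u - 1) / r)) => // [|m].
  exact: ratio_lt1.
rewrite -mulrA v_signM; apply: le_trans (v_div_succ _ _) _.
by rewrite ler_piMl ?exprn_ge0 // ltW // (lt_le_trans ur r_le1).
Qed.

Lemma vlog_le (u : K) : v (u - 1) < r -> v (vlog v u) <= v (u - 1).
Proof.
move=> ur; have := @vcvg_tail _ _ (v (u - 1)) 0 (vlog_cvg ur).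
rewrite big_geq // subr0; apply=> m _.
by rewrite -mulrA v_signM v_div_succ_le.
Qed.

(** The identity n C(n-1, m) = (m+1) C(n, m+1) pulls n out of all coefficients, so that division by
    n leaves a sum close to the logarithm series. *)
Lemma expr1D_sub1 (h : K) (n : nat) :
  (1 + h) ^+ n - 1 =
  n%:R * \sum_(0 <= m < n) 'C(n.-1, m)%:R * (h ^+ m.+1 / m.+1%:R).
Proof.
rewrite exprDn big_ord_recl bin0 mulr1n subn0 expr1n expr0 mulr1 addrAC subrr.
rewrite add0r mulr_sumr big_mkord; apply: eq_bigr => i _.
rewrite expr1n mul1r lift0 -mulr_natr.
have := mul_bin_diag n i; move/(congr1 (fun n => n%:R : K)); rewrite !natrM => E.
rewrite mulrA E; move: (natr_neq0 (ltn0Sn i)); move: (i.+1%:R : K) => y y0.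
by field.
Qed.

(** Once n is factored out, the term u - 1 strictly dominates: every other one carries an extra
    factor |u - 1| / r < 1. *)
Lemma v_expr_sub1 (u : K) (n : nat) : v (u - 1) < r -> (0 < n)%N ->
  v (u ^+ n - 1) = v n%:R * v (u - 1).
Proof.
move=> ur; case: n => // n _.
have [->|u1] := eqVneq u 1; first by rewrite expr1n subrr v0 mulr0.
rewrite -[in LHS](subrKC 1 u) expr1D_sub1 vM; congr (_ * _).
have h0 : 0 < v (u - 1) by rewrite v_gt0 subr_eq0.
rewrite big_nat_recl // bin0 mul1r expr1 divr1; apply: v_dominant.
apply: (@le_lt_trans _ _ (v (u - 1) * (v (u - 1) / r))); last first.
  by rewrite gtr_pMr // ratio_lt1.
apply: v_sum_le => [|i _]; first by rewrite mulr_ge0.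
apply: le_trans (v_natM_le _ _) _; apply: le_trans (v_div_succ _ _) _.
rewrite ler_wpM2l // exprS ler_piMr //.
by rewrite exprn_ile1 // ltW // ratio_lt1.
Qed.

(* Modulo n, the falling factorial (n - 1)...(n - m) is (-1)^m m!. *)
Lemma v_bin_sub_sign (n m : nat) : (0 < n)%N ->
  v ('C(n.-1, m)%:R - (-1) ^+ m) * v m`!%:R <= v n%:R.
Proof.
case: n => // n _ /=; elim: m => [|m IH].
  by rewrite bin0 expr0 subrr v0 mul0r.
have -> : 'C(n, m.+1)%:R - (-1) ^+ m.+1 =
          'C(n.+1, m.+1)%:R - ('C(n, m)%:R - (-1) ^+ m) :> K.
  by rewrite binS natrD exprS; ring.
rewrite -vM mulrBl; apply: vB_le; rewrite factS natrM.
  rewrite mulrA -natrM mulnC -mul_bin_diag /= natrM -mulrA vM ler_piMr //.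
  by rewrite -natrM v_nat_le1.
by rewrite mulrCA; apply: le_trans (v_natM_le _ _) _; rewrite vM.
Qed.

(** Both expressions are sums of n terms, with coefficients (-1)^m and C(n-1, m). By
    [v_bin_sub_sign] these differ by at most |n| / |m!|, and the factor (u-1)^(m+1) / (m+1) is at
    most |m!|. *)
Lemma vlog_approx (u : K) (n : nat) : v (u - 1) < r -> (0 < n)%N ->
  v (\sum_(0 <= m < n) (-1) ^+ m * (u - 1) ^+ m.+1 / m.+1%:R
     - (u ^+ n - 1) / n%:R) <= v n%:R.
Proof.
move=> ur n0; rewrite -[in X in _ - X](subrKC 1 u) expr1D_sub1.
rewrite mulrAC mulfV ?natr_neq0 // mul1r -sumrB.
apply: v_sum_le => // m _; rewrite -mulrA -mulrBl vM v_distC.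
apply: le_trans (v_bin_sub_sign m n0); rewrite ler_wpM2l //.
have h1 : v (u - 1) <= 1 := ltW (lt_le_trans ur r_le1).
rewrite vM vX vV ler_pdivrMr ?v_nat_gt0 // -vM -natrM mulnC -factS.
apply: le_trans (v_fact_ge m); rewrite exprS.
apply: (@le_trans _ _ (v (u - 1) ^+ m)); first by rewrite ler_piMl ?exprn_ge0.
by apply: lerXn2r; rewrite ?nnegrE ?(ltW r_gt0) ?(ltW ur).
Qed.

(** This is [v_expr_sub1] for a / b. The equality allows two elements near 1 to be compared through
    their n-th powers. *)
Lemma v_exprB (a b : K) (n : nat) : v (a - 1) < r -> v (b - 1) < r ->
  (0 < n)%N -> v (a ^+ n - b ^+ n) = v n%:R * v (a - b).
Proof.
move=> ar br n0.
have vb : v b = 1.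
  by rewrite -(subrKC 1 b) v_dominant v1 // (lt_le_trans br r_le1).
have b0 : b != 0 by rewrite -v_neq0 vb oner_neq0.
have ab : v (a / b - 1) = v (a - b).
  by rewrite -[X in _ - X](divff b0) -mulrBl vM vV vb invr1 mulr1.
have abr : v (a / b - 1) < r.
  have E : a - b = (a - 1) - (b - 1) by ring.
  by rewrite ab E vD_lt ?vN.
have := v_expr_sub1 abr n0; rewrite ab => <-.
rewrite expr_div_n -[X in _ / _ - X](divff (expf_neq0 n b0)) -mulrBl vM vV vX vb.
by rewrite expr1n invr1 mulr1.
Qed.

(* Compare M-th powers for M = p^N: (exp z)^M = exp (M z) is 1 + M z up to
   O(M^2), and u^M is 1 + M log u up to o(M). *)
Lemma vexp_vlog (u : K) : v (u - 1) < r -> vexp v (vlog v u) = u.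
Proof.
move=> ur; set z := vlog v u.
have zu : v z <= v (u - 1) := vlog_le ur.
have zr : v z < r := le_lt_trans zu ur.
have Er : v (vexp v z - 1) < r := le_lt_trans (vexp_sub1_le zr) zr.
apply/eqP; rewrite -subr_eq0 -[_ == 0]negbK -v_gt0; apply/negP => e0.
have [N1 h1] := v_pX_cvg e0.
have [N2 h2] := (vcvgP _ _).1 (vlog_cvg ur) _ e0.
(* Both |M| and the error of the logarithm series cut after M terms are now below |exp z - u|. *)
pose N := maxn N1 N2; pose M := (p ^ N)%N.
have M0 : (0 < M)%N by rewrite expn_gt0 prime_gt0.
have vM0 := v_nat_gt0 M0.
have Me : v M%:R < v (vexp v z - u) by apply: h1; rewrite leq_maxl.
have N2M : (N2 <= M)%N.
  by apply: leq_trans (leq_maxr N1 N2) _; rewrite ltnW // ltn_expl // prime_gt1.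
have Mz : v (M%:R * z) < r := le_lt_trans (v_natM_le _ _) zr.
have := v_exprB Er ur M0; rewrite -vexp_natM // => E.
suff : v (vexp v (M%:R * z) - u ^+ M) < v M%:R * v (vexp v z - u).
  by rewrite E ltxx.
have -> : vexp v (M%:R * z) - u ^+ M =
   (vexp v (M%:R * z) - 1 - M%:R * z) + M%:R * (z - (u ^+ M - 1) / M%:R).
  by field; exact: natr_neq0.
apply: vD_lt.
  apply: le_lt_trans (vexp_sub_linear_le Mz) _.
  rewrite {1}vM -mulrA ltr_pM2l //; apply: le_lt_trans Me.
  rewrite vM -mulrA mulrCA ler_piMr // mulr_ile1 //.
    exact: ltW (lt_le_trans zr r_le1).
  by rewrite ltW // ratio_lt1.
rewrite vM ltr_pM2l //.
set S := \sum_(0 <= m < M) (-1) ^+ m * (u - 1) ^+ m.+1 / m.+1%:R.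
rewrite (_ : z - _ = (z - S) + (S - (u ^+ M - 1) / M%:R)); last by ring.
apply: vD_lt; first by rewrite [v (z - S)]v_distC; apply: h2.
exact: le_lt_trans (vlog_approx ur M0) Me.
Qed.

(** * Powers of q and q-averages *)

Section QPower.
Variable q : K.
Hypotheses (q_r : v (q - 1) < r).

Let vlog_q_lt : v (vlog v q) < r := le_lt_trans (vlog_le q_r) q_r.

(** Here exp (log q) = q enters; it turns the averages into sums of ordinary powers. *)
Lemma qpow_nat (n : nat) : qpow v q n%:R = q ^+ n.
Proof. by rewrite /qpow vexp_natM // vexp_vlog. Qed.

Lemma qpow_exponent_lt (a : K) : v a <= 1 -> v (a * vlog v q) < r.
Proof. by move=> a1; rewrite vM; apply: le_lt_trans vlog_q_lt; rewrite ler_piMl. Qed.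

Lemma qpowD_nat (a : K) (n : nat) : v a <= 1 ->
  qpow v q (a + n%:R) = qpow v q a * q ^+ n.
Proof.
move=> a1; rewrite -qpow_nat /qpow mulrDl vexpD //; apply: qpow_exponent_lt => //.
exact: v_nat_le1.
Qed.

Lemma v_qpow (a : K) : v a <= 1 -> v (qpow v q a) = 1.
Proof. by move=> a1; apply/v_vexp/qpow_exponent_lt. Qed.

Lemma v_qpow_sub1 (a : K) : v a <= 1 -> v (qpow v q a - 1) <= v (q - 1).
Proof.
move=> a1; apply: le_trans (vexp_sub1_le (qpow_exponent_lt a1)) _.
by rewrite vM; apply: le_trans (vlog_le q_r); rewrite ler_piMl.
Qed.

Lemma v_base : v q = 1.
Proof. by rewrite -[q]expr1 -qpow_nat v_qpow ?v1. Qed.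

Lemma v_expr_sub1_le (n : nat) : v (q ^+ n - 1) <= v n%:R.
Proof.
case: n => [|n]; first by rewrite expr0 subrr v0.
rewrite v_expr_sub1 // ler_piMr // ltW //; exact: lt_le_trans q_r r_le1.
Qed.

Lemma expr_near1 (n : nat) : v (q ^+ n - 1) < r.
Proof.
by rewrite -qpow_nat; apply: le_lt_trans (v_qpow_sub1 (v_nat_le1 n)) q_r.
Qed.

Hypothesis (q_neq1 : q != 1).

Let vq1_gt0 : 0 < v (1 - q).
Proof. by rewrite v_gt0 subr_eq0 eq_sym. Qed.

Lemma expr_neq1 (n : nat) : (0 < n)%N -> q ^+ n != 1.
Proof.
move=> n0; rewrite -subr_eq0 -v_neq0 v_expr_sub1 // mulf_neq0 //.
  by rewrite gt_eqF // v_nat_gt0.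
by rewrite v_neq0 subr_eq0.
Qed.

Lemma v_qnum_le1 (a : K) : v a <= 1 -> v (qnum v q a) <= 1.
Proof.
move=> a1; rewrite vM vV ler_pdivrMr // mul1r v_distC [v (1 - q)]v_distC.
exact: v_qpow_sub1.
Qed.

Lemma qnum_nat (n : nat) : qnum v q n%:R = (1 - q ^+ n) / (1 - q).
Proof. by rewrite /qnum qpow_nat. Qed.

Lemma v_qnum_nat (n : nat) : v (qnum v q n%:R) = v n%:R.
Proof.
case: n => [|n]; first by rewrite qnum_nat expr0 subrr mul0r.
rewrite qnum_nat vM vV v_distC v_expr_sub1 // [v (q - 1)]v_distC mulfK //.
by rewrite gt_eqF.
Qed.

Lemma v_qnumDB (a : K) (m n : nat) : v a <= 1 ->
  v (qnum v q (a + (m + n)%:R) - qnum v q (a + m%:R)) <= v n%:R.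
Proof.
move=> a1.
have -> : qnum v q (a + (m + n)%:R) - qnum v q (a + m%:R) =
          qpow v q a * q ^+ m * qnum v q n%:R.
  by rewrite qnum_nat /qnum !qpowD_nat // exprD; ring.
rewrite vM v_qnum_nat vM v_qpow // vX v_base expr1n !mul1r.
by [].
Qed.

(** The average <f>_n; at n = p^N it is the expression under the limit in [qintegral]. *)
Definition qmean (f : nat -> K) (n : nat) : K :=
  (qnum v q n%:R)^-1 * \sum_(0 <= y < n) f y * q ^+ y.

Lemma qnum_natM (m n : nat) :
  qnum v q (m * n)%:R = qnum v q n%:R * \sum_(0 <= i < m) q ^+ (i * n).
Proof.
rewrite !qnum_nat mulnC exprM -[1 - _ ^+ m]opprB subrX1 big_mkord.
under [in RHS]eq_bigr do rewrite mulnC exprM.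
by rewrite mulrAC -mulNr opprB.
Qed.

(** Both averages are put over the denominator [mn], whose absolute value is |mn|. Each term of the
    difference compares f at y + i n with f at y and is at most e |n|, which leaves e / |m|. *)
Lemma qmean_mul_close (f : nat -> K) (e : R) (m n : nat) :
  0 <= e -> (0 < m)%N -> (0 < n)%N ->
  (forall a b, v (f (a + b)%N - f a) <= e * v b%:R) ->
  v (qmean f (m * n) - qmean f n) <= e / v m%:R.
Proof.
move=> e0 m0 n0 lip.
have nz k : (0 < k)%N -> qnum v q k%:R != 0.
  by move=> k0; rewrite -v_neq0 v_qnum_nat gt_eqF // v_nat_gt0.
have -> : qmean f (m * n) - qmean f n = (qnum v q (m * n)%:R)^-1 *
    \sum_(0 <= i < m) \sum_(0 <= y < n)
      (f (y + i * n)%N - f y) * q ^+ (y + i * n).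
  (* Extending f periodically from the first n integers to all m n of them does not change its
     average, because [mn] = [n] times the sum of the q^(i n). *)
  have E : qmean f n = (qnum v q (m * n)%:R)^-1 *
      \sum_(0 <= i < m) \sum_(0 <= y < n) f y * q ^+ (y + i * n).
    have mn0 : (0 < m * n)%N by rewrite muln_gt0 m0.
    apply: (mulfI (nz _ mn0)); rewrite mulVKf ?nz // /qmean.
    rewrite qnum_natM mulrCA mulrA mulKf ?nz // mulr_suml.
    apply: eq_bigr => i _; rewrite mulr_sumr; apply: eq_bigr => y _.
    by rewrite exprD; ring.
  rewrite E /qmean sum_nat_mul -mulrBr -sumrB; congr (_ * _).
  apply: eq_bigr => i _; rewrite -sumrB; apply: eq_bigr => y _.
  by rewrite mulrBl.
rewrite vM vV v_qnum_nat natrM vM invfM -mulrA [leRHS]mulrC.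
rewrite ler_pM2l ?invr_gt0 ?v_nat_gt0 // mulrC ler_pdivrMr ?v_nat_gt0 //.
apply: v_sum_le => [|i _]; first by rewrite mulr_ge0.
apply: v_sum_le => [|y _]; first by rewrite mulr_ge0.
rewrite vM vX v_base expr1n mulr1; apply: le_trans (lip _ _) _.
by rewrite ler_wpM2l // natrM v_natM_le.
Qed.

(** The average is a quotient of geometric sums, arranged so that n occurs only through q^n and in
    no denominator. *)
Lemma qmean_exp (k n : nat) : (0 < n)%N ->
  qmean (fun y => (q ^+ y) ^+ k) n =
  (1 - q) / (1 - q ^+ k.+1) * \sum_(0 <= j < k.+1) (q ^+ n) ^+ j.
Proof.
move=> n0; rewrite /qmean qnum_nat.
have E : \sum_(0 <= y < n) (q ^+ y) ^+ k * q ^+ y =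
         \sum_(0 <= y < n) (q ^+ k.+1) ^+ y.
  by apply: eq_bigr => y _; rewrite -exprSr -!exprM mulnC.
rewrite E !big_mkord.
have nz i : (0 < i)%N -> 1 - q ^+ i != 0.
  by move=> i0; rewrite subr_eq0 eq_sym expr_neq1.
have q1 : 1 - q != 0 by rewrite subr_eq0 eq_sym.
apply: (mulfI (nz n n0)); apply: (mulfI (nz k.+1 isT)).
have := subrX1 (q ^+ k.+1) n; have := subrX1 (q ^+ n) k.+1.
rewrite -!exprM [(k.+1 * n)%N]mulnC => -> H.
move: (nz n n0) (nz k.+1 isT); move: H.
move: (\sum_(i < n) _) (\sum_(i < k.+1) _) => A B.
move: (q ^+ n) (q ^+ k.+1) => a b H a0 b0.
transitivity (- (1 - q) * ((b - 1) * A)); first by field; rewrite q1 a0.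
by rewrite -H; field.
Qed.

(** By linearity F may be a power. In the formula of [qmean_exp], q^n is within |n| of 1, so for n =
    m p^N and n = p^N the two values differ by at most a constant times |p^N|. *)
Lemma qmean_poly_cvg (F : {poly K}) (m : nat) : (0 < m)%N ->
  vcvg v (fun N => qmean (fun y => F.[q ^+ y]) (m * p ^ N)
                   - qmean (fun y => F.[q ^+ y]) (p ^ N)) 0.
Proof.
move=> m0.
pose D k N := qmean (fun y => (q ^+ y) ^+ k) (m * p ^ N)
              - qmean (fun y => (q ^+ y) ^+ k) (p ^ N).
have lin n : qmean (fun y => F.[q ^+ y]) n =
             \sum_(i < size F) F`_i * qmean (fun y => (q ^+ y) ^+ i) n.
  rewrite /qmean; under eq_bigr do rewrite horner_coef mulr_suml.
  rewrite exchange_big /= mulr_sumr; apply: eq_bigr => i _.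
  rewrite [RHS]mulrCA; congr (_ * _); rewrite mulr_sumr; apply: eq_bigr => y _.
  by rewrite mulrA.
suff : vcvg v (fun N => \sum_(i < size F) F`_i * D i N)
              (\sum_(i < size F) F`_i * 0).
  rewrite big1 => [|i _]; last by rewrite mulr0.
  move=> h; apply: (vcvg_ext h) => N; rewrite !lin -sumrB; apply: eq_bigr => i _.
  by rewrite mulrBr.
apply: vcvg_sum => i; apply: vcvgMl; apply/vcvgP => e e0.
pose C := (1 - q) / (1 - q ^+ i.+1).
have C0 : 0 < v C.
  rewrite v_gt0 mulf_neq0 ?invr_eq0 // subr_eq0 eq_sym ?expr_neq1 //.
have [N hN] := v_pX_cvg (divr_gt0 e0 C0); exists N => k Nk.
have pk : (0 < p ^ k)%N by rewrite expn_gt0 prime_gt0.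
rewrite subr0 /D !qmean_exp ?muln_gt0 ?m0 // -mulrBr -/C vM mulrC.
rewrite -ltr_pdivlMr //; apply: le_lt_trans (hN k Nk).
rewrite -sumrB; apply: v_sum_le => // j _; rewrite -!exprM.
rewrite (_ : _ - _ = (q ^+ (m * p ^ k * j) - 1) - (q ^+ (p ^ k * j) - 1));
  last by ring.
apply: vB_le; apply: le_trans (v_expr_sub1_le _) _.
  by rewrite mulnAC natrM v_natM_le.
by rewrite mulnC natrM v_natM_le.
Qed.

End QPower.

(** * The q-integral of the degenerate exponential *)

Section DPower.
Variables lam t : K.
Hypotheses (lam_neq0 : lam != 0) (lam_le1 : v lam <= 1) (t_r : v t < r).

(** The degenerate falling factorial: lam^m times the falling factorial of z / lam, written without
    division because z / lam can be large. *)
Definition dfall (m : nat) (z : K) : K := \prod_(i < m) (z - i%:R * lam).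

Let th := v t / r.

Lemma dpow_term (m : nat) (z : K) :
  gbinom (z / lam) m * lam ^+ m * t ^+ m = t ^+ m / m`!%:R * dfall m z.
Proof.
have -> : dfall m z = (\prod_(i < m) (z / lam - i%:R)) * lam ^+ m.
  have -> : lam ^+ m = \prod_(i < m) lam by rewrite prodr_const card_ord.
  rewrite -big_split /=; apply: eq_bigr => i _.
  by rewrite mulrBl divfK.
by rewrite /gbinom; ring.
Qed.

Lemma v_dfall_factor (z : K) (i : nat) : v z <= 1 -> v (z - i%:R * lam) <= 1.
Proof. by move=> z1; apply: vB_le => //; apply: le_trans (v_natM_le _ _) _. Qed.

Lemma v_dfall (m : nat) (z : K) : v z <= 1 -> v (dfall m z) <= 1.
Proof. by move=> z1; apply: v_prod_le1 => i _; apply: v_dfall_factor. Qed.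

Lemma v_dfallB (m : nat) (z z' : K) : v z <= 1 -> v z' <= 1 ->
  v (dfall m z - dfall m z') <= v (z - z').
Proof.
move=> z1 z1'; elim: m => [|m IH]; first by rewrite /dfall !big_ord0 subrr v0.
rewrite /dfall !big_ord_recr /= -/(dfall m z) -/(dfall m z').
rewrite (_ : _ - _ = (dfall m z - dfall m z') * (z - m%:R * lam)
                     + dfall m z' * (z - z')); last by ring.
apply: vD_le; rewrite vM.
  by apply: le_trans IH; rewrite ler_piMr // v_dfall_factor.
by rewrite ler_piMl // v_dfall.
Qed.

Let th_ge0 : 0 <= th := ratio_ge0 t.
Let th_lt1 : th < 1 := ratio_lt1 t_r.

Definition dpow_partial (n : nat) (z : K) : K :=
  \sum_(0 <= m < n) t ^+ m / m`!%:R * dfall m z.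

Lemma dpow_cvg (z : K) : v z <= 1 ->
  vcvg v (dpow_partial^~ z) (dpow v lam t z).
Proof.
move=> z1; suff -> : dpow v lam t z = vsum v (fun m => t ^+ m / m`!%:R * dfall m z).
  apply: (vsum_cvg th_ge0 th_lt1) => m; rewrite vM.
  apply: le_trans (v_div_fact_geo m t_r).
  by rewrite ler_piMr // v_dfall.
by congr vsum; apply/funext => m; apply: dpow_term.
Qed.

(** Every [dfall m] is 1-Lipschitz on the unit ball, so the tail inherits the size th^n of its
    coefficients as Lipschitz constant; n can make it as small as desired. *)
Lemma v_dpow_tailB (n : nat) (z z' : K) : v z <= 1 -> v z' <= 1 ->
  v ((dpow v lam t z - dpow_partial n z) - (dpow v lam t z' - dpow_partial n z'))
    <= th ^+ n * v (z - z').
Proof.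
move=> z1 z1'.
pose a m := t ^+ m / m`!%:R * (dfall m z - dfall m z').
have aE N : \sum_(0 <= m < N) a m = dpow_partial N z + -1 * dpow_partial N z'.
  rewrite mulN1r -sumrB; apply: eq_bigr => m _; exact: mulrBr.
have := vcvgD (dpow_cvg z1) (vcvgMl (-1) (dpow_cvg z1')).
move=> /vcvg_ext/(_ (fun N => esym (aE N))) ac.
rewrite (_ : _ - _ = dpow v lam t z + -1 * dpow v lam t z'
                      - \sum_(0 <= m < n) a m); last by rewrite aE; ring.
apply: (vcvg_tail ac) => m nm; rewrite vM ler_pM //; last exact: v_dfallB.
apply: le_trans (v_div_fact_geo m t_r) _.
by apply: ler_wiXn2l => //; apply: ltW.
Qed.

Lemma dpow_partial_poly (n : nat) (L : {poly K}) :
  exists F : {poly K}, forall u, F.[u] = dpow_partial n L.[u].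
Proof.
exists (\sum_(0 <= m < n) (t ^+ m / m`!%:R) *: \prod_(i < m) (L - (i%:R * lam)%:P)).
move=> u; rewrite horner_sum; apply: eq_bigr => m _; rewrite hornerZ horner_prod.
by congr (_ * _); apply: eq_bigr => i _; rewrite hornerD hornerN hornerC.
Qed.

Section Integral.
Variables (q : K) (W : nat) (a : K) (c : nat).
Hypotheses (q_r : v (q - 1) < r) (q_neq1 : q != 1).
Hypotheses (W_gt0 : (0 < W)%N) (a_le1 : v a <= 1).

Let Q := q ^+ W.
Let Q_r : v (Q - 1) < r := expr_near1 q_r W.
Let Q_neq1 : Q != 1 := expr_neq1 q_r q_neq1 W_gt0.

(** In the application [a] is P x and [c] is [kshift k]. The natural number part stays separate
    because it yields ordinary powers of q. *)
Let arg (y : nat) : K := qnum v q (a + (W * y + c)%:R).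

Let arg_le1 (y : nat) : v (arg y) <= 1.
Proof. by apply: v_qnum_le1 => //; apply: vD_le => //; apply: v_nat_le1. Qed.

Lemma qmean_dpow_close (w : nat) : (0 < w)%N ->
  vcvg v (fun N => qmean Q (fun y => dpow v lam t (arg y)) (w * p ^ N)
                   - qmean Q (fun y => dpow v lam t (arg y)) (p ^ N)) 0.
Proof.
move=> w0; apply/vcvgP => e e0.
have vw0 := v_nat_gt0 w0.
(* The series is cut where th^M < e |w|, to offset the loss of 1 / |w| in [qmean_mul_close]. *)
have [M hM] := expr_cvg0 th_ge0 th_lt1 (mulr_gt0 e0 vw0).
(* The argument is affine in Q^y, namely (1 - q^(a+c) Q^y) / (1 - q), so the truncated series is a
   polynomial in Q^y. *)
pose L : {poly K} := (1 - q)^-1 *: (1 - (qpow v q a * q ^+ c) *: 'X).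
have LE y : L.[Q ^+ y] = arg y.
  rewrite /arg /qnum qpowD_nat // /L /Q !hornerE -exprM exprD; ring.
have [F hF] := dpow_partial_poly M L.
have [N hN] := (vcvgP _ _).1 (qmean_poly_cvg Q_r Q_neq1 F w0) e e0.
exists N => k Nk; have := hN k Nk; rewrite !subr0 => small.
pose g y := dpow v lam t (arg y) - F.[Q ^+ y].
have split n : qmean Q (fun y => dpow v lam t (arg y)) n =
               qmean Q g n + qmean Q (fun y => F.[Q ^+ y]) n.
  rewrite /qmean -mulrDr -big_split /=; congr (_ * _); apply: eq_bigr => y _.
  by rewrite -mulrDl subrK.
rewrite !split.
rewrite (_ : _ - _ = (qmean Q g (w * p ^ k) - qmean Q g (p ^ k))
   + (qmean Q (fun y => F.[Q ^+ y]) (w * p ^ k)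
      - qmean Q (fun y => F.[Q ^+ y]) (p ^ k))); last by ring.
apply: vD_lt => //.
apply: (@le_lt_trans _ _ (th ^+ M / v w%:R)); last first.
  by rewrite ltr_pdivrMr // hM.
apply: qmean_mul_close => //; rewrite ?exprn_ge0 ?expn_gt0 ?prime_gt0 //.
move=> y b; rewrite /g !hF !LE.
apply: le_trans (v_dpow_tailB _ (arg_le1 _) (arg_le1 _)) _.
rewrite ler_wpM2l ?exprn_ge0 // /arg mulnDr addnAC.
by apply: le_trans (v_qnumDB _ _ _ _ _) _ => //; rewrite natrM v_natM_le.
Qed.

Lemma qintegral_dpow_cvg (w : nat) : (0 < w)%N ->
  vcvg v (fun N => qmean Q (fun y => dpow v lam t (arg y)) (w * p ^ N))
   (qintegral v p (qpow v q W%:R)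
      (fun y => dpow v lam t (qnum v q (W%:R * y + a + c%:R)))).
Proof.
move=> w0; set f := fun y : nat => dpow v lam t (arg y).
(* With w = p, [qmean_dpow_close] says that consecutive averages approach each other. The limit
   therefore exists, and [vlim] does not take its default value. *)
have [l hl] : exists l, vcvg v (fun N => qmean Q f (p ^ N)) l.
  apply: vcvg_increments; have := qmean_dpow_close (prime_gt0 p_prime).
  by under eq_fun do rewrite -expnS.
rewrite (_ : qintegral _ _ _ _ = l); last first.
  apply: vlimE; apply: (vcvg_ext hl) => N; rewrite /qmean (qpow_nat q_r).
  rewrite -/Q; congr (_ * _).
  apply: eq_bigr => y _.
  by rewrite (qpow_nat Q_r) /f /arg natrD natrM [W%:R * _ + a]addrC addrA.
by have := vcvg_close hl (qmean_dpow_close w0); rewrite addr0.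
Qed.

End Integral.
End DPower.

(** It merges the outer factor [W]_q with the denominator of the average for q^W into [P p^N]_q,
    which is independent of the permutation. *)
Lemma qnum_expM (q : K) (m n : nat) : v (q - 1) < r -> q != 1 -> (0 < m)%N ->
  qnum v q m%:R * qnum v (q ^+ m) n%:R = qnum v q (m * n)%:R.
Proof.
move=> qr q1 m0; have Qr := expr_near1 qr m; have Q1 := expr_neq1 qr q1 m0.
rewrite !qnum_nat // -exprM mulrC mulrA divfK //.
by rewrite subr_eq0 eq_sym.
Qed.

(** * Averages over a common range, and the symmetry *)

Section Symmetry.
Variables (q lam t x : K).
Hypotheses (q_r : v (q - 1) < r) (q_neq1 : q != 1) (t_r : v t < r).
Hypotheses (lam_neq0 : lam != 0) (lam_le1 : v lam <= 1) (x_le1 : v x <= 1).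
Variables (n : nat) (w : 'I_n.+1 -> nat).
Hypothesis w_gt0 : forall i, (0 < w i)%N.

Let P := (\prod_i w i)%N.
(** The outer power q^(kshift k) and the weight Q^y combine to q^m with m = W y + [kshift k], so a
    whole summand depends on m alone. *)
Let H (m : nat) : K := q ^+ m * dpow v lam t (qnum v q (P%:R * x + m%:R)).

(** The averages are taken over y < m p^N with m = w_(s n). Writing y = i + z m with i < m turns W y
    into P z + W i, since W m = P. *)
Lemma sym_expr_cvg (s : 'S_n.+1) :
  vcvg v (fun N => (qnum v q (P * p ^ N)%:R)^-1 * \sum_(0 <= z < p ^ N)
     \sum_(u : multi_index w s * 'I_(w (s ord_max)))
       H (P * z + (Wprod w s * u.2 + kshift u.1)))
    (sym_expr w s v p q lam t x).
Proof.
have W0 : (0 < Wprod w s)%N by rewrite prodn_gt0.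
have a1 : v (P%:R * x) <= 1 := le_trans (v_natM_le _ _) x_le1.
have PW : P = (Wprod w s * w (s ord_max))%N by rewrite Wprod_last.
apply: vcvg_ext (vcvgMl _ (vcvg_sum _ (fun k => vcvgMl _
  (qintegral_dpow_cvg lam_neq0 lam_le1 t_r (kshift k) q_r q_neq1 W0 a1
     (w_gt0 (s ord_max)))))) _ => N.
set W := Wprod w s; set m := w (s ord_max).
under eq_bigr => k _ do rewrite (qpow_nat q_r) /qmean mulrCA.
rewrite -mulr_sumr mulrA -invfM qnum_expM //.
rewrite mulnA -PW; congr (_^-1 * _).
rewrite -[RHS](eq_bigr _ (fun z _ => pair_big xpredT xpredT
  (fun (k : multi_index w s) (i : 'I_m) => H (P * z + (W * i + kshift k))))).
rewrite exchange_big /=; apply: eq_bigr => k _.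
rewrite [(m * _)%N]mulnC sum_nat_mul mulr_sumr; apply: eq_bigr => z _.
rewrite big_mkord mulr_sumr; apply: eq_bigr => i _.
have -> : (P * z + (W * i + kshift k) = W * (i + z * m) + kshift k)%N.
  by rewrite PW; lia.
by rewrite /H -exprM exprD; ring.
Qed.

(** The two approximating sequences agree term by term: for each z the inner sum is symmetric by
    [sum_shift_perm]. *)
Lemma sym_expr_perm (s s' : 'S_n.+1) :
  sym_expr w s v p q lam t x = sym_expr w s' v p q lam t x.
Proof.
apply: (vcvg_unique (sym_expr_cvg s)); apply: (vcvg_ext (sym_expr_cvg s')) => N.
congr (_ * _); apply: eq_bigr => z _.
exact: (sum_shift_perm w s' s (fun e => H (P * z + e))).
Qed.

End Symmetry.
End CpTheory.

Theorem theorem2p1 (R : realType) (p : nat) (K : fieldType) (v : K -> R)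
    (p_prime : prime p) (p_odd : odd p) (CpK : is_Cp v p)
    (q lam t : K)
    (q_neq1 : q != 1)
    (q_near1 : v (1 - q) < p%:R `^ (- ((p%:R - 1)^-1)))
    (lam_neq0 : lam != 0) (lam_le1 : v lam <= 1)
    (t_small : v t < p%:R `^ (- ((p%:R - 1)^-1)))
    (n : nat) (w : 'I_n.+1 -> nat) (w_gt0 : forall i : 'I_n.+1, (0 < w i)%N)
    (x : K) (x_Zp : in_Zp v x) :
  forall s s' : 'S_n.+1,
    sym_expr w s v p q lam t x = sym_expr w s' v p q lam t x.
Proof.
move=> s s'; set r := p%:R `^ _ in q_near1 t_small.
have p_gt1 := prime_gt1 p_prime.
have r_gt0 : 0 < r by rewrite powR_gt0 // ltr0n prime_gt0.
have r_pow : r ^+ p.-1 = p%:R^-1.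
  have p1 : p.-1%:R = p%:R - 1 :> R by rewrite -subn1 natrB // prime_gt0.
  rewrite -powR_mulrn ?ltW // -powRrM p1 mulNr mulVf ?powR_inv1 //.
  by rewrite subr_eq0 pnatr_eq1; case: (p) p_gt1 => [|[]].
apply: (sym_expr_perm p_prime CpK r_gt0 r_pow) => //.
  by rewrite (v_distC CpK).
by case: x_Zp.
Qed.
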